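(* Let $V$ and $W$ be real operator systems. Then $(V\otimes_{\min}W)_c\cong V_c\otimes_{\min}W_c$ (canonically) as complex operator systems; that is, $V_c\otimes_{\min}W_c$ is the operator system complexification of $V\otimes_{\min}W$.
   Context: A real operator system is a unital selfadjoint real subspace of $B(H)$, $H$ a real Hilbert space, with matrix cones $M_n(V)^+$ (up to unital complete order isomorphism). The complexification of a real operator system $V$ is the complex operator system $V_c=V+iV$ with $(x+iy)^*=x^*-iy^*$, the same unit, and $M_n(V_c)^+=\{x+iy:x=x^*,\,y=-y^*\in M_n(V),\ \begin{bmatrix} x & -y \\ y & x \end{bmatrix}\in M_{2n}(V)^+\}$. As vector spaces $(V\otimes_{\mathbb{R}}W)_c=V_c\otimes_{\mathbb{C}}W_c$ canonically. A ucp map is a linear unital completely positive map. For operator systems over $\mathbb{F}=\mathbb{R}$ or $\mathbb{C}$, $V\otimes_{\min}W$ is $V\otimes W$ with unit $e_V\otimes e_W$ and cones: $x\in M_n(V\otimes_{\min}W)^+$ iff $(\varphi\otimes\psi)^{(n)}(x)\ge0$ for all $m,k\in\mathbb{N}$ and all ucp maps $\varphi:V\to M_m(\mathbb{F})$, $\psi:W\to M_k(\mathbb{F})$. *)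

(* Defs.v *)
From HB Require Import structures.
From mathcomp Require Import all_boot all_order all_algebra.
From mathcomp Require Import generic_quotient sesquilinear.
From mathcomp Require Import complex mxtens.
From mathcomp Require Import boolp classical_sets reals topology normedtype.

Set Implicit Arguments.
Unset Strict Implicit.
Unset Printing Implicit Defensive.

Import GRing.Theory Num.Theory.

Local Open Scope quotient_scope.
Local Open Scope ring_scope.
Local Open Scope complex_scope.

(* F-balanced biadditive maps into abelian groups: the maps classified by the
   tensor product over F. *)
Definition balanced (F : comNzRingType) (V W : lmodType F) (U : zmodType)
    (b : V -> W -> U) : Prop :=
  [/\ forall v v' w, b (v + v') w = b v w + b v' w,
      forall v w w', b v (w + w') = b v w + b v w' &
      forall a v w, b (a *: v) w = b v (a *: w)].

Section Tensor.
Variables (F : comNzRingType) (V W : lmodType F).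
Implicit Types (s : seq (V * W)) (U : zmodType).

Definition tsum U (b : V -> W -> U) s : U := \sum_(p <- s) b p.1 p.2.

(* A formal sum [:: (v_1, w_1); ...; (v_k, w_k)] stands for
   v_1 ⊗ w_1 + ... + v_k ⊗ w_k; two of them are equal in V ⊗ W iff no balanced
   map tells them apart. *)
Definition tensor_rel s s' : bool :=
  `[< forall U (b : V -> W -> U), balanced b -> tsum b s = tsum b s' >].

Lemma tensor_rel_refl : reflexive tensor_rel.
Proof. by move=> s; apply/asboolP. Qed.

Lemma tensor_rel_sym : symmetric tensor_rel.
Proof.
by move=> s s'; apply/asboolP/asboolP => h U b /h.
Qed.

Lemma tensor_rel_trans : transitive tensor_rel.
Proof.
move=> s2 s1 s3 /asboolP h12 /asboolP h23; apply/asboolP => U b hb.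
by rewrite h12 // h23.
Qed.

Canonical tensor_equiv :=
  EquivRel tensor_rel tensor_rel_refl tensor_rel_sym tensor_rel_trans.

Definition tensor := {eq_quot tensor_equiv}.
HB.instance Definition _ := Choice.on tensor.
HB.instance Definition _ := EqQuotient.on tensor.

Definition tmk s : tensor := \pi_tensor s.

Definition tens (v : V) (w : W) : tensor := tmk [:: (v, w)].

(* The map V ⊗ W -> U induced by b; meaningful for balanced b. *)
Definition tlift U (b : V -> W -> U) (t : tensor) : U := tsum b (repr t).

Lemma tlift_mk U (b : V -> W -> U) s : balanced b -> tlift b (tmk s) = tsum b s.
Proof.
move=> hb; rewrite /tlift /tmk.
have : \pi_tensor (repr (\pi_tensor s)) = \pi_tensor s by rewrite reprK.
by move/eqmodP/asboolP; apply.
Qed.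

Lemma tensorP (t t' : tensor) :
  (forall U (b : V -> W -> U), balanced b -> tlift b t = tlift b t') -> t = t'.
Proof.
move=> h; rewrite -[t]reprK -[t']reprK; apply/eqmodP/asboolP => U b hb.
exact: h.
Qed.

Definition tzero : tensor := tmk [::].
Definition topp (t : tensor) : tensor :=
  tmk [seq (- p.1, p.2) | p <- repr t].
Definition tadd (t t' : tensor) : tensor := tmk (repr t ++ repr t').
Definition tscale (a : F) (t : tensor) : tensor :=
  tmk [seq (a *: p.1, p.2) | p <- repr t].

Lemma balancedN U (b : V -> W -> U) v w : balanced b -> b (- v) w = - b v w.
Proof.
case=> hl _ _; have b0 : b 0 w = 0.
  by apply: (@addrI _ (b 0 w)); rewrite -hl !addr0.
by apply: (@addrI _ (b v w)); rewrite -hl !subrr.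
Qed.

Lemma balancedZ U (b : V -> W -> U) a :
  balanced b -> balanced (fun v w => b (a *: v) w).
Proof.
case=> hl hr hZ; split=> [v v' w|v w w'|c v w].
- by rewrite scalerDr hl.
- by rewrite hr.
- by rewrite -hZ !scalerA mulrC.
Qed.

Lemma tlift_zero U (b : V -> W -> U) : balanced b -> tlift b tzero = 0.
Proof. by move=> hb; rewrite tlift_mk // /tsum big_nil. Qed.

Lemma tlift_opp U (b : V -> W -> U) t :
  balanced b -> tlift b (topp t) = - tlift b t.
Proof.
move=> hb; rewrite tlift_mk // /tlift /tsum big_map /= -sumrN.
by apply: eq_bigr => p _; rewrite balancedN.
Qed.

Lemma tlift_add U (b : V -> W -> U) t t' :
  balanced b -> tlift b (tadd t t') = tlift b t + tlift b t'.
Proof. by move=> hb; rewrite tlift_mk // /tsum big_cat. Qed.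

Lemma tlift_scale U (b : V -> W -> U) a t : balanced b ->
  tlift b (tscale a t) = tlift (fun v w => b (a *: v) w) t.
Proof. by move=> hb; rewrite tlift_mk // /tsum big_map. Qed.

Fact taddA : associative tadd.
Proof. by move=> x y z; apply: tensorP => U b hb; rewrite !tlift_add // addrA. Qed.
Fact taddC : commutative tadd.
Proof. by move=> x y; apply: tensorP => U b hb; rewrite !tlift_add // addrC. Qed.
Fact tadd0 : left_id tzero tadd.
Proof.
by move=> x; apply: tensorP => U b hb; rewrite tlift_add // tlift_zero // add0r.
Qed.
Fact taddN : left_inverse tzero topp tadd.
Proof.
move=> x; apply: tensorP => U b hb.
by rewrite tlift_add // tlift_zero // tlift_opp // addNr.
Qed.

HB.instance Definition _ := GRing.isZmodule.Build tensor taddA taddC tadd0 taddN.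

Lemma tliftD U (b : V -> W -> U) t t' :
  balanced b -> tlift b (t + t') = tlift b t + tlift b t'.
Proof. exact: tlift_add. Qed.

Fact tscaleA a b t : tscale a (tscale b t) = tscale (a * b) t.
Proof.
apply: tensorP => U f hf; rewrite !tlift_scale //; last exact: balancedZ.
by apply: eq_bigr => p _; rewrite scalerA mulrC.
Qed.
Fact tscale1 : left_id 1 tscale.
Proof.
move=> t; apply: tensorP => U f hf; rewrite !tlift_scale //.
by apply: eq_bigr => p _; rewrite scale1r.
Qed.
Fact tscaleDr : right_distributive tscale +%R.
Proof.
move=> a t t'; apply: tensorP => U f hf.
by rewrite tliftD // !tlift_scale // tliftD //; apply: balancedZ.
Qed.
Fact tscaleDl t : {morph tscale^~ t : a b / a + b}.
Proof.
move=> a b; apply: tensorP => U f hf; rewrite tliftD // !tlift_scale //.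
rewrite /tlift /tsum -big_split; apply: eq_bigr => p _ /=.
by case: hf => hl _ _; rewrite scalerDl hl.
Qed.

HB.instance Definition _ :=
  GRing.Zmodule_isLmodule.Build F tensor tscaleA tscale1 tscaleDr tscaleDl.

Lemma tliftZ U (b : V -> W -> U) a t : balanced b ->
  tlift b (a *: t) = tlift (fun v w => b (a *: v) w) t.
Proof. exact: tlift_scale. Qed.

Lemma tliftE U (b : V -> W -> U) v w : balanced b -> tlift b (tens v w) = b v w.
Proof. by move=> hb; rewrite tlift_mk // /tsum big_seq1. Qed.

Lemma tensDl v v' w : tens (v + v') w = tens v w + tens v' w.
Proof.
apply: tensorP => U b hb; rewrite tliftD // !tliftE //.
by case: hb => ->.
Qed.

Lemma tensDr v w w' : tens v (w + w') = tens v w + tens v w'.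
Proof.
apply: tensorP => U b hb; rewrite tliftD // !tliftE //.
by case: hb => _ ->.
Qed.

Lemma tensZl a v w : tens (a *: v) w = a *: tens v w.
Proof.
apply: tensorP => U b hb; rewrite tliftZ // !tliftE //; exact: balancedZ.
Qed.

Lemma tensZr a v w : tens v (a *: w) = a *: tens v w.
Proof.
rewrite -tensZl; apply: tensorP => U b hb; rewrite !tliftE //.
by case: hb => _ _ ->.
Qed.

Lemma tens_span (t : tensor) : t = \sum_(p <- repr t) tens p.1 p.2.
Proof.
apply: tensorP => U b hb; rewrite [LHS]/tlift.
elim: (repr t) => [|p s IH].
  by rewrite /tsum !big_nil; apply: esym (tlift_zero hb).
by rewrite /tsum !big_cons tliftD // tliftE // -IH.
Qed.

End Tensor.

Notation "v ⊗ w" := (tens v w)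
  (at level 40, left associativity) : ring_scope.

(* [T_ij] is a positive element of M_n(B(H)) = B(H^n); self-adjointness does not
   follow from the positivity of the quadratic form over the reals. *)
Definition block_positive (F : numFieldType) (H : lmodType F)
    (dot : H -> H -> F) (n : nat) (T : 'I_n -> 'I_n -> H -> H) : Prop :=
  (forall i j x y, dot (T i j x) y = dot x (T j i y)) /\
  (forall x : 'I_n -> H, 0 <= \sum_i \sum_j dot (T i j (x j)) (x i)).

(* A *-vector space over F with a unit and a set of matrices at every level; c is
   the conjugation of F: the identity over the reals, Num.conj over R[i]. That it
   is an operator system is the predicate operator_system below. *)
Record mo_space (F : numFieldType) (c : involutive_rmorphism F) := MOSpace {
  mo_sort :> lmodType F;
  star : mo_sort -> mo_sort;
  starK : involutive star;
  starD : {morph star : x y / x + y};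
  starZ : forall a x, star (a *: x) = c a *: star x;
  mo_unit : mo_sort;
  mo_pos : forall n : nat, 'M[mo_sort]_n -> Prop
}.

Arguments star {F c m} x : rename.
Arguments mo_unit {F c} m : rename.
Arguments mo_pos {F c m n} X : rename.

Definition mxstar (F : numFieldType) (c : involutive_rmorphism F)
  (V : mo_space c) (n : nat) (X : 'M[V]_n) : 'M[V]_n := map_mx star X^T.

(* J identifies V with a unital selfadjoint subspace of B(H), with the matrix
   cones inherited from B(H). *)
Definition operator_system (F : numFieldType) (c : involutive_rmorphism F)
    (V : mo_space c) : Prop :=
  exists (H : completeNormedModType F) (dot : {dot H for c})
         (J : V -> {linear H -> H}),
    (forall x : H, `|x| ^+ 2 = dot x x) /\
    (forall v, exists M : F, forall x : H, `|J v x| <= M * `|x|) /\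
    (forall a v w x, J (a *: v + w) x = a *: J v x + J w x) /\
    (forall v w, J v =1 J w -> v = w) /\
    (forall x, J (mo_unit V) x = x) /\
    (forall v x y, dot (J v x) y = dot x (J (star v) y)) /\
    (forall n (X : 'M[V]_n),
       mo_pos X <-> block_positive dot (fun i j => J (X i j))).

Definition ucp (F : numFieldType) (c : involutive_rmorphism F)
    (V W : mo_space c) (f : {linear V -> W}) : Prop :=
  f (mo_unit V) = mo_unit W /\
  forall n (X : 'M[V]_n), mo_pos X -> mo_pos (map_mx f X).

Definition unital_complete_order_iso (F : numFieldType)
    (c : involutive_rmorphism F) (V W : mo_space c) (f : {linear V -> W}) : Prop :=
  [/\ bijective f, f (mo_unit V) = mo_unit W,
      forall v, f (star v) = star (f v) &
      forall n (X : 'M[V]_n), mo_pos X <-> mo_pos (map_mx f X)].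

Section MatrixSystem.
Variables (F : numFieldType) (c : involutive_rmorphism F) (m : nat).

Definition cdot (x y : 'cV[F]_m) : F := \sum_i x i 0 * c (y i 0).

Definition adjmx (A : 'M[F]_m) : 'M[F]_m := map_mx c A^T.

Fact adjmxK : involutive adjmx.
Proof. by move=> A; apply/matrixP => i j; rewrite !mxE rmorphK. Qed.

Fact adjmxD : {morph adjmx : A B / A + B}.
Proof. by move=> A B; apply/matrixP => i j; rewrite !mxE rmorphD. Qed.

Fact adjmxZ a A : adjmx (a *: A) = c a *: adjmx A.
Proof. by apply/matrixP => i j; rewrite !mxE rmorphM. Qed.

Definition matrix_system : mo_space c :=
  @MOSpace F c 'M[F]_m adjmx adjmxK adjmxD adjmxZ 1%:M
    (fun n (X : 'M['M[F]_m]_n) =>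
       block_positive cdot (fun i j => mulmx (X i j))).

End MatrixSystem.

Section MinTensor.
Variables (F : numFieldType) (c : involutive_rmorphism F) (V W : mo_space c).

(* M_m(F) ⊗ M_k(F) is identified with M_(m * k)(F) by the Kronecker product. *)
Definition tensor_map (m k : nat) (f : {linear V -> matrix_system c m})
    (g : {linear W -> matrix_system c k}) :
    tensor V W -> matrix_system c (m * k) :=
  tlift (fun v w => tensmx (f v : 'M[F]_m) (g w : 'M[F]_k)).

Definition tstar (t : tensor V W) : tensor V W :=
  tlift (fun v w => star v ⊗ star w) t.

Lemma balanced_star : balanced (fun (v : V) (w : W) => star v ⊗ star w).
Proof.
split=> [v v' w|v w w'|a v w].
- by rewrite starD tensDl.
- by rewrite starD tensDr.
- by rewrite !starZ tensZl tensZr.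
Qed.

Lemma tstarE v w : tstar (v ⊗ w) = star v ⊗ star w.
Proof. by rewrite /tstar tliftE //; apply: balanced_star. Qed.

Fact tstarD : {morph tstar : t t' / t + t'}.
Proof. by move=> t t'; rewrite /tstar tliftD //; apply: balanced_star. Qed.

Fact tstarZ a t : tstar (a *: t) = c a *: tstar t.
Proof.
rewrite /tstar tliftZ; last exact: balanced_star.
by rewrite /tlift /tsum scaler_sumr; apply: eq_bigr => p _; rewrite starZ tensZl.
Qed.

Fact tstarK : involutive tstar.
Proof.
move=> t; rewrite {2}[t]tens_span [in LHS](tens_span t).
have tstar0 : tstar 0 = 0 by apply: (@addrI _ (tstar 0)); rewrite -tstarD !addr0.
elim: (repr t) => [|p s IH]; first by rewrite !big_nil !tstar0.
by rewrite !big_cons !tstarD IH !tstarE !starK.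
Qed.

Definition min_tensor : mo_space c :=
  @MOSpace F c (tensor V W) tstar tstarK tstarD tstarZ
    (mo_unit V ⊗ mo_unit W)
    (fun n (X : 'M[tensor V W]_n) =>
       forall (m k : nat) (f : {linear V -> matrix_system c m})
              (g : {linear W -> matrix_system c k}),
         ucp f -> ucp g ->
         mo_pos (map_mx (tensor_map f g) X : 'M[matrix_system c (m * k)]_n)).

End MinTensor.

Definition real_mo_space (R : realType) := @mo_space R (@idfun R).
Definition complex_mo_space (R : realType) := @mo_space R[i] (@Num.conj R[i]).

Section Complexification.
Variable R : realType.

(* The pair (x, y) stands for x + iy. *)
Definition cplx (V : lmodType R) : Type := (V * V)%type.

Section Lmodule.
Variable V : lmodType R.

HB.instance Definition _ := GRing.Zmodule.copy (cplx V) (V * V)%type.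

Definition cplx_scale (a : R[i]) (z : cplx V) : cplx V :=
  (complex.Re a *: z.1 - complex.Im a *: z.2,
   complex.Re a *: z.2 + complex.Im a *: z.1).

Fact cplx_scaleA a b z : cplx_scale a (cplx_scale b z) = cplx_scale (a * b) z.
Proof.
case: a b z => [a a'] [b b'] [x y]; congr pair => /=.
  rewrite scalerBr scalerDr !scalerBl !scalerDl !scalerA !opprD.
  by rewrite -!addrA; congr (_ + _); rewrite addrA addrC.
rewrite scalerBr scalerDr !scalerBl !scalerDl !scalerA.
by rewrite -!addrA; congr (_ + _); rewrite [RHS]addrCA [_ - _]addrC.
Qed.

Fact cplx_scale1 : left_id 1 cplx_scale.
Proof.
by case=> x y; rewrite /cplx_scale /= !scale1r !scale0r subr0 addr0.
Qed.

Fact cplx_scaleDr : right_distributive cplx_scale +%R.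
Proof.
move=> a [x y] [x' y']; congr pair => /=; rewrite !scalerDr ?opprD.
  by rewrite addrACA.
by rewrite addrACA.
Qed.

Fact cplx_scaleDl z : {morph cplx_scale^~ z : a b / a + b}.
Proof.
case: z => x y [a a'] [b b']; congr pair => /=; rewrite !scalerDl ?opprD.
  by rewrite addrACA.
by rewrite addrACA.
Qed.

HB.instance Definition _ := GRing.Zmodule_isLmodule.Build R[i] (cplx V)
  cplx_scaleA cplx_scale1 cplx_scaleDr cplx_scaleDl.

End Lmodule.

Variable V : real_mo_space R.

Definition cplx_star (z : cplx V) : cplx V := (star z.1, - star z.2).

Lemma rstarN (x : V) : star (- x) = - star x.
Proof. by rewrite -scaleN1r starZ /= scaleN1r. Qed.

Fact cplx_starK : involutive cplx_star.
Proof. by case=> x y; rewrite /cplx_star /= rstarN opprK !starK. Qed.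

Fact cplx_starD : {morph cplx_star : x y / x + y}.
Proof.
by case=> [x y] [x' y']; rewrite /cplx_star /= !starD opprD.
Qed.

Fact cplx_starZ a z : cplx_star (a *: z) = Num.conj a *: cplx_star z.
Proof.
case: a z => [a b] [x y]; congr pair => /=.
  by rewrite starD rstarN !starZ /= scaleNr scalerN opprK.
by rewrite starD !starZ /= opprD scalerN scaleNr.
Qed.

Definition complexification : complex_mo_space R :=
  @MOSpace R[i] (@Num.conj R[i]) (cplx V) cplx_star cplx_starK cplx_starD
    cplx_starZ (mo_unit V, 0)
    (fun n (Z : 'M[cplx V]_n) =>
       let x : 'M[V]_n := map_mx fst Z in
       let y : 'M[V]_n := map_mx snd Z in
       [/\ x = mxstar x, y = - mxstar y &
           mo_pos (block_mx x (- y) y x : 'M[V]_(n + n))]).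

End Complexification.

(* Main.v *)
(* A complex ucp map F : V_c -> M_m(C) restricts to a real ucp map
   V -> M_m(C) ⊂ M_2m(R), and F is recovered from the complexification of that
   map by compressing with an isometry C^m -> C^2m; conversely real ucp maps
   extend to complex ones.  Since compressions preserve positivity, testing
   against complex ucp maps of V_c and W_c amounts to testing against real ucp
   maps of V and W.  That positive matrices over V_c ⊗ W_c come from a
   symmetric real part and an antisymmetric imaginary part holds because real
   compressions to finite dimensional subspaces separate the points of V ⊗ W. *)
Require Import Defs.
From HB Require Import structures.
From mathcomp Require Import all_boot all_order all_algebra.
From mathcomp Require Import generic_quotient sesquilinear complex mxtens.
From mathcomp Require Import boolp reals topology normedtype.
From mathcomp Require Import ring.

Set Implicit Arguments.
Unset Strict Implicit.
Unset Printing Implicit Defensive.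

Import GRing.Theory Num.Theory.

Local Open Scope ring_scope.

(** * Positive block matrices with entries in a full matrix algebra, and their compressions *)

Section MatrixPositivity.
Variables (F : numFieldType) (c : involutive_rmorphism F).

Definition mxadj m n (A : 'M[F]_(m, n)) : 'M[F]_(n, m) := map_mx c A^T.

Lemma mxadjK m n (A : 'M[F]_(m, n)) : mxadj (mxadj A) = A.
Proof. by apply/matrixP => i j; rewrite !mxE rmorphK. Qed.

Lemma mxadjN m n (A : 'M[F]_(m, n)) : mxadj (- A) = - mxadj A.
Proof. by rewrite /mxadj raddfN map_mxN. Qed.

Lemma mxadj_mul m n p (A : 'M[F]_(m, n)) (B : 'M[F]_(n, p)) :
  mxadj (A *m B) = mxadj B *m mxadj A.
Proof. by rewrite /mxadj trmx_mul map_mxM. Qed.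

Lemma cdotE m (x y : 'cV[F]_m) : cdot c x y = (mxadj y *m x) 0 0.
Proof. by rewrite mxE; apply: eq_bigr => i _; rewrite !mxE mulrC. Qed.

Lemma cdotC m (x y : 'cV[F]_m) : cdot c x y = c (cdot c y x).
Proof.
by rewrite rmorph_sum; apply: eq_bigr => i _; rewrite rmorphM /= rmorphK mulrC.
Qed.

Lemma cdotDl m (x y z : 'cV[F]_m) : cdot c (x + y) z = cdot c x z + cdot c y z.
Proof. by rewrite !cdotE mulmxDr mxE. Qed.

Lemma cdot_mull m n (A : 'M[F]_(m, n)) (x : 'cV[F]_n) (y : 'cV[F]_m) :
  cdot c (A *m x) y = cdot c x (mxadj A *m y).
Proof. by rewrite !cdotE mxadj_mul mxadjK mulmxA. Qed.

Lemma cdot_delta m (A : 'M[F]_m) i j :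
  cdot c (A *m delta_mx j 0) (delta_mx i 0) = A i j.
Proof.
rewrite -colE /cdot (bigD1 i) //= big1 ?addr0 => [|k /negPf ki];
  by rewrite !mxE ?eqxx ?ki ?rmorph1 ?rmorph0 ?mulr1 ?mulr0.
Qed.

Lemma mxpos_adj m n (X : 'M[matrix_system c m]_n) i j :
  mo_pos X -> mxadj (X i j : 'M_m) = X j i.
Proof.
case=> hX _; apply/matrixP => k l.
by rewrite -[RHS]cdot_delta hX cdotC cdot_delta !mxE.
Qed.

Lemma mxposP m n (X : 'M[matrix_system c m]_n) :
  mo_pos X <->
  (forall i j, mxadj (X i j : 'M_m) = X j i) /\
  (forall x : 'I_n -> 'cV[F]_m,
     0 <= \sum_i \sum_j cdot c ((X i j : 'M_m) *m x j) (x i)).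
Proof.
split=> [hX|[hX hX0]]; first by split=> [i j|]; [apply: mxpos_adj | case: hX].
by split=> // i j x y; rewrite cdot_mull hX.
Qed.

Lemma mxpos_compress m p n (T : 'M[F]_(p, m)) (X : 'M[matrix_system c p]_n)
    (Y : 'M[matrix_system c m]_n) :
  (forall i j, (Y i j : 'M_m) = mxadj T *m (X i j : 'M_p) *m T) ->
  mo_pos X -> mo_pos Y.
Proof.
move=> hY /mxposP [hX hX0]; apply/mxposP; split=> [i j|x].
  by rewrite !hY !mxadj_mul mxadjK mulmxA hX.
have := hX0 (fun i => T *m x i); congr (0 <= _).
apply: eq_bigr => i _; apply: eq_bigr => j _.
by rewrite hY -!mulmxA [RHS]cdot_mull mxadjK.
Qed.

(** Conjugation exchanges the indices i and j. Over R[i] this makes the quadratic form real-valued,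
    so positivity can be tested on real parts. *)
Lemma mxform_selfconj m n (X : 'M[matrix_system c m]_n) (x : 'I_n -> 'cV[F]_m) :
  (forall i j, mxadj (X i j : 'M_m) = X j i) ->
  let q := \sum_i \sum_j cdot c ((X i j : 'M_m) *m x j) (x i) in c q = q.
Proof.
move=> hX q; rewrite /q [RHS]exchange_big rmorph_sum; apply: eq_bigr => i _.
rewrite rmorph_sum; apply: eq_bigr => j _.
by rewrite /= -cdotC -[X j i]hX cdot_mull mxadjK.
Qed.

End MatrixPositivity.

(** * Complex matrices as pairs of real ones, and positivity across the two fields *)

Section Realification.
Variable R : realType.
Local Notation cj := (@Num.conj R[i] : involutive_rmorphism R[i]).
Implicit Types x y : R[i].

Lemma Im_sum I (r : seq I) (P : pred I) (F : I -> R[i]) :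
  complex.Im (\sum_(i <- r | P i) F i) = \sum_(i <- r | P i) complex.Im (F i).
Proof. exact: (raddf_sum (@complex.Im R : Rcomplex R -> R)). Qed.

Lemma Re_sum I (r : seq I) (P : pred I) (F : I -> R[i]) :
  complex.Re (\sum_(i <- r | P i) F i) = \sum_(i <- r | P i) complex.Re (F i).
Proof. exact: (raddf_sum (@complex.Re R : Rcomplex R -> R)). Qed.

Lemma ReM x y :
  complex.Re (x * y) =
  complex.Re x * complex.Re y - complex.Im x * complex.Im y.
Proof. by case: x y => [a b] [c d]. Qed.

Lemma ImM x y :
  complex.Im (x * y) =
  complex.Re x * complex.Im y + complex.Im x * complex.Re y.
Proof. by case: x y => [a b] [c d]. Qed.

Lemma conj_complexE x : cj x = Complex (complex.Re x) (- complex.Im x).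
Proof. by case: x. Qed.

Definition mxRe m n (C : 'M[R[i]]_(m, n)) : 'M[R]_(m, n) :=
  map_mx (@complex.Re R) C.
Definition mxIm m n (C : 'M[R[i]]_(m, n)) : 'M[R]_(m, n) :=
  map_mx (@complex.Im R) C.
Definition mxC m n (A B : 'M[R]_(m, n)) : 'M[R[i]]_(m, n) :=
  map2_mx (@Complex R) A B.

Lemma mxReC m n (A B : 'M[R]_(m, n)) : mxRe (mxC A B) = A.
Proof. by apply/matrixP => i j; rewrite !mxE. Qed.
Lemma mxImC m n (A B : 'M[R]_(m, n)) : mxIm (mxC A B) = B.
Proof. by apply/matrixP => i j; rewrite !mxE. Qed.

Lemma mxRe_mul m n p (A : 'M_(m, n)) (B : 'M_(n, p)) :
  mxRe (A *m B) = mxRe A *m mxRe B - mxIm A *m mxIm B.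
Proof.
apply/matrixP => i j; rewrite !mxE Re_sum -sumrB.
by apply: eq_bigr => k _; rewrite !mxE ReM.
Qed.

Lemma mxIm_mul m n p (A : 'M_(m, n)) (B : 'M_(n, p)) :
  mxIm (A *m B) = mxRe A *m mxIm B + mxIm A *m mxRe B.
Proof.
apply/matrixP => i j; rewrite !mxE Im_sum -big_split.
by apply: eq_bigr => k _; rewrite !mxE ImM.
Qed.

Lemma mxadjC m n (C : 'M_(m, n)) :
  mxadj cj C = mxC (mxadj idfun (mxRe C)) (- mxadj idfun (mxIm C)).
Proof. by apply/matrixP => i j; rewrite !mxE conj_complexE. Qed.

Lemma Re_cdot m (x y : 'cV[R[i]]_m) :
  complex.Re (cdot cj x y) =
  cdot idfun (mxRe x) (mxRe y) + cdot idfun (mxIm x) (mxIm y).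
Proof.
rewrite Re_sum -big_split; apply: eq_bigr => i _.
by rewrite !mxE ReM conj_complexE /= mulrN opprK.
Qed.

(** In R[i], [0 <= q] demands a zero imaginary part and a nonnegative real part; selfadjointness
    supplies the former through [mxform_selfconj]. *)
Lemma mxposC_Re m n (X : 'M[matrix_system cj m]_n) :
  mo_pos X <->
  (forall i j, mxadj cj (X i j : 'M_m) = X j i) /\
  (forall x : 'I_n -> 'cV[R[i]]_m,
     0 <= complex.Re (\sum_i \sum_j cdot cj ((X i j : 'M_m) *m x j) (x i))).
Proof.
rewrite mxposP; split=> [] [hX h0]; split=> // x.
  by have := h0 x; rewrite lecE => /andP[].
rewrite lecE h0 andbT /=; have := mxform_selfconj x hX.
move: (\sum_i _) => q /= /(congr1 (@complex.Im R)).
rewrite conj_complexE /= => /eqP; rewrite -subr_eq0 -opprD oppr_eq0.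
by rewrite -mulr2n mulrn_eq0.
Qed.

(** The matrix of C acting on C^m, seen as R^m ⊕ R^m through x ↦ (Re x, Im x). *)
Definition realify m (C : 'M[R[i]]_m) : 'M[R]_(m + m) :=
  block_mx (mxRe C) (- mxIm C) (mxIm C) (mxRe C).

Lemma realify_adj m (C : 'M_m) :
  realify (mxadj cj C) = mxadj idfun (realify C).
Proof.
rewrite /realify mxadjC mxReC mxImC opprK /mxadj tr_block_mx map_block_mx.
by rewrite -![map_mx _ _^T]/(mxadj _ _) mxadjN.
Qed.

Lemma mul_realify m (C : 'M_m) (x : 'cV_m) :
  realify C *m col_mx (mxRe x) (mxIm x) =
  col_mx (mxRe (C *m x)) (mxIm (C *m x)).
Proof.
by rewrite mul_block_col mxRe_mul mxIm_mul mulNmx [X in col_mx _ X]addrC.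
Qed.

Lemma cdot_col m n (u u' : 'cV[R]_m) (v v' : 'cV[R]_n) :
  cdot idfun (col_mx u v) (col_mx u' v') = cdot idfun u u' + cdot idfun v v'.
Proof.
rewrite /cdot big_split_ord /=; congr (_ + _); apply: eq_bigr => i _;
by rewrite ?col_mxEu ?col_mxEd.
Qed.

(** Every vector of R^(2m) is (Re z, Im z) for some z in C^m, and the real form there is the real
    part of the complex form at z. *)
Lemma mxpos_realify m n (X : 'M[matrix_system cj m]_n) :
  mo_pos X ->
  mo_pos (map_mx (@realify m) X : 'M[matrix_system idfun (m + m)]_n).
Proof.
move=> /mxposC_Re [hX h0]; apply/mxposP; split=> [i j|x].
  by rewrite !mxE -realify_adj hX.
pose z i : 'cV[R[i]]_m := mxC (usubmx (x i)) (dsubmx (x i)).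
have hz i : x i = col_mx (mxRe (z i)) (mxIm (z i)).
  by rewrite mxReC mxImC vsubmxK.
have := h0 z; congr (0 <= _); rewrite Re_sum; apply: eq_bigr => i _.
rewrite Re_sum; apply: eq_bigr => j _.
by rewrite mxE [x j]hz [x i]hz mul_realify cdot_col Re_cdot.
Qed.

(** This reads the block condition in the cone of [complexification] for the system M_m(R) as
    positivity over M_m(C). In contrast to [realify], the doubling affects the outer index n and
    leaves m alone. *)
Lemma mxpos_block m n (A B : 'M['M[R]_m]_n) :
  mo_pos (block_mx A (- B) B A : 'M[matrix_system idfun m]_(n + n)) <->
  mo_pos (map2_mx (@mxC m m) A B : 'M[matrix_system cj m]_n).
Proof.
(* With u = (Re x, Im x) along the outer index, the four blocks add up to the real part of the
   complex form. Both directions use this: one builds u from x, the other x from u. *)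
have form (x : 'I_n -> 'cV[R[i]]_m) (u : 'I_(n + n) -> 'cV[R]_m) :
    (forall i, u (lshift n i) = mxRe (x i)) ->
    (forall i, u (rshift n i) = mxIm (x i)) ->
  \sum_i \sum_j cdot idfun
     (((block_mx A (- B) B A : 'M[matrix_system idfun m]_(n + n)) i j : 'M_m)
        *m u j) (u i) =
  complex.Re (\sum_i \sum_j
     cdot cj (((map2_mx (@mxC m m) A B : 'M[matrix_system cj m]_n) i j : 'M_m)
               *m x j) (x i)).
  move=> hl hr; rewrite big_split_ord /= Re_sum -big_split.
  apply: eq_bigr => i _; rewrite /= !big_split_ord /= Re_sum -!big_split.
  apply: eq_bigr => j _ /=; rewrite block_mxEul block_mxEur block_mxEdl.
  rewrite block_mxEdr !mxE !hl !hr Re_cdot mxRe_mul mxIm_mul !mxReC !mxImC.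
  by rewrite !cdotDl mulNmx [X in _ = _ + X]addrC addrACA.
rewrite mxposP mxposC_Re; split=> -[hX h0]; split.
(* The diagonal block yields symmetry of A; the upper right block, where -B faces B, yields the
   antisymmetry of B that conjugation requires. *)
- move=> i j; have := hX (lshift n i) (lshift n j).
  have := hX (lshift n i) (rshift n j).
  rewrite !block_mxEul block_mxEur block_mxEdl !mxE => hB hA.
  rewrite mxadjC mxReC mxImC -hA -hB; congr mxC.
  by apply/matrixP => k l; rewrite !mxE.
- move=> x.
  pose u k := match split k with inl i => mxRe (x i) | inr i => mxIm (x i) end.
  rewrite -(form x u) // => i; rewrite /u.
    by rewrite (unsplitK (inl i)).
  by rewrite (unsplitK (inr i)).
- have hA i j : mxadj idfun (A i j) = A j i.
    by have := congr1 (@mxRe m m) (hX i j); rewrite !mxE mxadjC !mxReC.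
  have hB i j : mxadj idfun (B i j) = - B j i.
    have := congr1 (@mxIm m m) (hX i j); rewrite !mxE mxadjC !mxImC => <-.
    by rewrite opprK.
  move=> i j; case: (split_ordP i) => {}i ->; case: (split_ordP j) => {}j ->;
  rewrite ?block_mxEul ?block_mxEur ?block_mxEdl ?block_mxEdr ?hA // !mxE ?hB //.
  by rewrite mxadjN hB opprK.
- move=> u; rewrite (form (fun i => mxC (u (lshift n i)) (u (rshift n i)))) //.
    by move=> i; rewrite mxReC.
  by move=> i; rewrite mxImC.
Qed.

End Realification.

(** * Kronecker products and the maps they induce on tensor products *)

Lemma tensmxDl (F : comPzRingType) m n p q (A A' : 'M[F]_(m, n)) (B : 'M_(p, q)) :
  tensmx (A + A') B = tensmx A B + tensmx A' B.
Proof. by apply/matrixP => i j; rewrite !mxE mulrDl. Qed.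

Lemma tensmxDr (F : comPzRingType) m n p q (A : 'M[F]_(m, n)) (B B' : 'M_(p, q)) :
  tensmx A (B + B') = tensmx A B + tensmx A B'.
Proof. by apply/matrixP => i j; rewrite !mxE mulrDr. Qed.

Lemma tensmxZl (F : comPzRingType) m n p q a (A : 'M[F]_(m, n)) (B : 'M_(p, q)) :
  tensmx (a *: A) B = a *: tensmx A B.
Proof. by apply/matrixP => i j; rewrite !mxE mulrA. Qed.

Lemma tensmxZr (F : comPzRingType) m n p q a (A : 'M[F]_(m, n)) (B : 'M_(p, q)) :
  tensmx A (a *: B) = a *: tensmx A B.
Proof. by apply/matrixP => i j; rewrite !mxE mulrCA. Qed.

Lemma tensor_ind (F : comNzRingType) (V W : lmodType F)
    (P : tensor V W -> Prop) :
  P 0 -> (forall v w, P (v ⊗ w)) -> (forall t t', P t -> P t' -> P (t + t')) ->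
  forall t, P t.
Proof.
move=> h0 ht hD t; rewrite [t]tens_span.
by elim/big_ind: _ => // p _.
Qed.

(** A lift of a balanced map is additive, but homogeneity depends on the map. Taking [phi] merely
    additive allows it to be multiplication by a scalar of another ring, as happens when a real
    tensor product maps into a complex one. *)
Lemma tliftZ_scaling (F : comNzRingType) (V W : lmodType F) (U : zmodType)
    (b : V -> W -> U) (phi : {additive U -> U}) a : balanced b ->
  (forall v w, b (a *: v) w = phi (b v w)) ->
  forall t, tlift b (a *: t) = phi (tlift b t).
Proof.
move=> hb hphi t; rewrite tliftZ // /tlift /tsum raddf_sum.
by apply: eq_bigr => p _; rewrite hphi.
Qed.

Section TensorMap.
Variables (F : numFieldType) (c : involutive_rmorphism F) (V W : mo_space c).
Variables (m k : nat).
Variables (f : {linear V -> matrix_system c m}).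
Variables (g : {linear W -> matrix_system c k}).

Lemma balanced_tensor_map :
  balanced (fun v w => tensmx (f v : 'M[F]_m) (g w : 'M[F]_k)).
Proof.
split=> [v v' w|v w w'|a v w].
- by rewrite raddfD tensmxDl.
- by rewrite raddfD tensmxDr.
- by rewrite !linearZ /= tensmxZl tensmxZr.
Qed.

Lemma tensor_mapE v w :
  tensor_map f g (v ⊗ w) = tensmx (f v : 'M[F]_m) (g w : 'M[F]_k).
Proof. exact: tliftE balanced_tensor_map. Qed.

Lemma tensor_map_linear : linear (tensor_map f g).
Proof.
move=> a t t'; rewrite /tensor_map tliftD; last exact: balanced_tensor_map.
congr (_ + _); have hb := balanced_tensor_map.
apply: (@tliftZ_scaling _ _ _ _ _ ( *:%R a) _ hb) => v w.
by rewrite linearZ /= tensmxZl.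
Qed.

HB.instance Definition _ :=
  GRing.isLinear.Build F (tensor V W) (matrix_system c (m * k)) _
    (tensor_map f g) tensor_map_linear.

End TensorMap.

Lemma addr_swap24 (M : zmodType) (x y z t : M) :
  x + (y + (z + t)) = x + (t + (z + y)).
Proof. by congr (_ + _); rewrite addrC -addrA addrCA. Qed.

(** The left side is the image under (x, y) ↦ x + iy of the pair that [cplx_scale] assigns to the
    scalar p + iq; this is the homogeneity of [theta]. *)
Lemma cplx_expand (K : comNzRingType) (M : lmodType K) (i p q : K) (x y : M) :
  i * i = -1 ->
  p *: x - q *: y + i *: (p *: y + q *: x) = (p + i * q) *: (x + i *: y).
Proof.
move=> hi; rewrite scalerDl !scalerDr !scalerA mulrAC hi mulN1r scaleNr.
by rewrite [i * p]mulrC [LHS]addrACA [X in _ + X]addrC.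
Qed.

(** * The canonical complex-linear bijection [theta], its inverse, and the star *)

Section Theta.
Variables (R : realType) (V W : real_mo_space R).

Definition cinl (U : real_mo_space R) (u : U) : complexification U := (u, 0).

Lemma cinlD (U : real_mo_space R) : {morph @cinl U : u v / u + v}.
Proof. by move=> u v; congr pair; rewrite addr0. Qed.

Lemma cinlZ (U : real_mo_space R) a (u : U) :
  cinl (a *: u) = (real_complex R a : R[i]) *: cinl u.
Proof.
by congr pair; rewrite /= ?scaler0 ?scale0r ?subr0 ?addr0.
Qed.

Definition ci : R[i] := Complex 0 1.

Lemma cinl_split (U : real_mo_space R) (z : complexification U) :
  z = cinl z.1 + ci *: cinl z.2.
Proof.
case: z => x y; congr pair;
  by rewrite /= ?scaler0 ?scale0r ?scale1r ?subr0 ?addr0 ?add0r.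
Qed.

Lemma balanced_iota :
  balanced (fun (v : V) (w : W) => cinl v ⊗ cinl w).
Proof.
split=> [v v' w|v w w'|a v w].
- by rewrite cinlD tensDl.
- by rewrite cinlD tensDr.
- by rewrite !cinlZ tensZl tensZr.
Qed.

Definition iota_tensor (t : tensor V W) :
    min_tensor (complexification V) (complexification W) :=
  tlift (fun v w => cinl v ⊗ cinl w) t.

Lemma iota_tensorE v w : iota_tensor (v ⊗ w) = cinl v ⊗ cinl w.
Proof. exact: tliftE balanced_iota. Qed.

Fact iota_tensor_additive : nmod_morphism iota_tensor.
Proof.
split=> [|t t']; first exact: tlift_zero balanced_iota.
exact: tliftD balanced_iota.
Qed.

HB.instance Definition _ := GRing.isNmodMorphism.Build (tensor V W)
  (min_tensor (complexification V) (complexification W))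
  iota_tensor iota_tensor_additive.

Lemma iota_tensorZ a t :
  iota_tensor (a *: t) = (real_complex R a : R[i]) *: iota_tensor t.
Proof.
pose phi : {additive tensor (complexification V) (complexification W) -> _} :=
  *:%R (real_complex R a : R[i]).
apply: (@tliftZ_scaling _ _ _ _ _ phi _ balanced_iota) => v w.
by rewrite cinlZ tensZl.
Qed.

Definition theta (z : complexification (min_tensor V W)) :
    min_tensor (complexification V) (complexification W) :=
  iota_tensor z.1 + ci *: iota_tensor z.2.

Lemma theta_linear : linear theta.
Proof.
move=> a z z'.
have thetaD x y : theta (x + y) = theta x + theta y.
  by rewrite /theta !raddfD addrACA.
rewrite thetaD; congr (_ + _).
case: z => x y.
rewrite -[LHS]/(iota_tensor (complex.Re a *: (x : tensor V W) -
    complex.Im a *: (y : tensor V W)) +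
  ci *: iota_tensor (complex.Re a *: (y : tensor V W) +
    complex.Im a *: (x : tensor V W))).
rewrite raddfB raddfD /= !iota_tensorZ.
rewrite [in RHS](complexE a) -cplx_expand //; exact: sqr_i.
Qed.

HB.instance Definition _ := GRing.isLinear.Build _
  (complexification (min_tensor V W))
  (min_tensor (complexification V) (complexification W)) _ theta theta_linear.

Lemma theta_cinl v w : theta (v ⊗ w, 0) = cinl v ⊗ cinl w.
Proof. by rewrite /theta /= raddf0 scaler0 addr0 iota_tensorE. Qed.

(** The expansion of (x + iy) ⊗ (x' + iy') into real and imaginary parts; it induces the inverse of
    [theta]. *)
Definition pure_mul (z : complexification V) (z' : complexification W) :
    complexification (min_tensor V W) :=
  (z.1 ⊗ z'.1 - z.2 ⊗ z'.2, z.1 ⊗ z'.2 + z.2 ⊗ z'.1).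

Lemma tensNl (F : comNzRingType) (V1 W1 : lmodType F) (v : V1) (w : W1) :
  (- v) ⊗ w = - (v ⊗ w).
Proof. by rewrite -scaleN1r tensZl scaleN1r. Qed.

Lemma tensNr (F : comNzRingType) (V1 W1 : lmodType F) (v : V1) (w : W1) :
  v ⊗ (- w) = - (v ⊗ w).
Proof. by rewrite -scaleN1r tensZr scaleN1r. Qed.

Lemma tens0l (F : comNzRingType) (V1 W1 : lmodType F) (w : W1) :
  (0 : V1) ⊗ w = 0.
Proof. by rewrite -(scale0r (0 : V1)) tensZl scale0r. Qed.

Lemma tens0r (F : comNzRingType) (V1 W1 : lmodType F) (v : V1) :
  v ⊗ (0 : W1) = 0.
Proof. by rewrite -(scale0r (0 : W1)) tensZr scale0r. Qed.

Lemma pure_mulZl a z z' : pure_mul (a *: z) z' = a *: pure_mul z z'.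
Proof.
case: a z z' => a b [x y] [x' y']; congr pair => /=.
  rewrite !tensDl tensNl !tensZl !scalerDr scalerN !opprD -!addrA.
  by congr (_ + _); rewrite [LHS]addrC -addrA.
rewrite !tensDl tensNl !tensZl !scalerDr scalerN -!addrA.
by congr (_ + _); rewrite [LHS]addrC -addrA.
Qed.

Lemma balanced_pure_mul : balanced pure_mul.
Proof.
have mulD (x x' : complexification V) y :
    pure_mul (x + x') y = pure_mul x y + pure_mul x' y.
  by congr pair; rewrite /= !tensDl ?opprD addrACA.
have mulDr x (y y' : complexification W) :
    pure_mul x (y + y') = pure_mul x y + pure_mul x y'.
  by congr pair; rewrite /= !tensDr ?opprD addrACA.
split=> // a z z'; case: a z z' => a b [x y] [x' y']; congr pair => /=.
  rewrite !tensDl !tensDr tensNl tensNr !tensZl !tensZr !opprD -!addrA.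
  exact: addr_swap24.
rewrite !tensDl !tensDr tensNl tensNr !tensZl !tensZr -!addrA.
exact: addr_swap24.
Qed.

Definition theta_inv
    (t : min_tensor (complexification V) (complexification W)) :
    complexification (min_tensor V W) := tlift pure_mul t.

Lemma theta_inv0 : theta_inv 0 = 0.
Proof. exact: tlift_zero balanced_pure_mul. Qed.

Lemma theta_invD : {morph theta_inv : t t' / t + t'}.
Proof. by move=> t t'; apply: tliftD balanced_pure_mul. Qed.

Lemma theta_invZ a t : theta_inv (a *: t) = a *: theta_inv t.
Proof.
pose phi : {additive complexification (min_tensor V W) -> _} := *:%R a.
by apply: (@tliftZ_scaling _ _ _ _ _ phi _ balanced_pure_mul) => v w;
  apply: pure_mulZl.
Qed.

Lemma theta_inv_tens v w : theta_inv (v ⊗ w) = pure_mul v w.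
Proof. exact: tliftE balanced_pure_mul. Qed.

Lemma theta_pure_mul z z' : theta (pure_mul z z') = z ⊗ z'.
Proof.
rewrite [in RHS](cinl_split z) [in RHS](cinl_split z') /theta /pure_mul /=.
rewrite !raddfD raddfN /= !iota_tensorE !tensDl !tensDr !tensZl !tensZr.
rewrite scalerA -[ci * ci]/(ci ^+ 2) sqr_i scaleN1r -!addrA.
by congr (_ + _); rewrite addrC -addrA.
Qed.

Lemma theta_invK : cancel theta_inv theta.
Proof.
elim/tensor_ind => [|v w|t t' IH IH'].
- by rewrite theta_inv0 raddf0.
- by rewrite theta_inv_tens theta_pure_mul.
- by rewrite theta_invD raddfD /= IH IH'.
Qed.

Lemma theta_inv_iota (t : tensor V W) :
  theta_inv (iota_tensor t) = cinl (t : min_tensor V W).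
Proof.
elim/tensor_ind: t => [|v w|t t' IH IH'].
- by rewrite raddf0 theta_inv0.
- rewrite iota_tensorE theta_inv_tens /pure_mul /cinl /=.
  by rewrite !tens0r tens0l subr0 addr0.
- by rewrite raddfD /= theta_invD IH IH' [RHS]cinlD.
Qed.

Lemma thetaK : cancel theta theta_inv.
Proof.
move=> z; rewrite [RHS]cinl_split /theta theta_invD theta_invZ.
by rewrite !theta_inv_iota.
Qed.

Lemma star0 (F : numFieldType) (c : involutive_rmorphism F)
    (V1 : mo_space c) : star (0 : V1) = 0.
Proof. by rewrite -[0 in LHS](scale0r (0 : V1)) starZ rmorph0 scale0r. Qed.

Lemma tstar0 (F : numFieldType) (c : involutive_rmorphism F)
    (V1 W1 : mo_space c) : tstar (0 : tensor V1 W1) = 0.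
Proof. exact: tlift_zero (balanced_star _ _). Qed.

(** Conjugation turns i into -i, which is the sign that [cplx_star] puts on the second component;
    what remains is that the real inclusion commutes with the star. *)
Lemma theta_star z : theta (star z) = star (theta z).
Proof.
have iota_star t : iota_tensor (tstar t) = tstar (iota_tensor t).
  elim/tensor_ind: t => [|v w|t t' IH IH'].
  - by rewrite tstar0 !raddf0 tstar0.
  - rewrite tstarE !iota_tensorE [RHS]tstarE.
    by rewrite /cinl /= /cplx_star /= !star0 !oppr0.
  - by rewrite tstarD !raddfD /= IH IH' [RHS]tstarD.
rewrite /theta -[RHS]/(tstar _) tstarD tstarZ -!iota_star.
rewrite (_ : _ ci = - ci) ?scaleNr; last first.
  by rewrite [LHS]conj_complexE; apply/eqP; rewrite eq_complex /= oppr0 !eqxx.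
rewrite -scalerN -raddfN; congr (_ + _ *: _).
Qed.

End Theta.

(** * Properties of the cones drawn from a representation on a Hilbert space *)

Section OperatorSystem.
Variables (F : numFieldType) (c : involutive_rmorphism F) (V : mo_space c).

Lemma dot_ext (H : completeNormedModType F) (dot : {dot H for c}) (u v : H) :
  (forall x : H, `|x| ^+ 2 = dot x x) ->
  (forall y, dot u y = dot v y) -> u = v.
Proof.
move=> hn huv; apply/eqP; rewrite -subr_eq0 -normr_eq0 -sqrf_eq0 hn.
by rewrite linearBl /= huv subrr.
Qed.

Hypothesis hV : operator_system V.

(** The represented block operator is selfadjoint, and J is injective and turns [star] into the
    adjoint. *)
Lemma mo_pos_star n (X : 'M[V]_n) i j : mo_pos X -> star (X i j) = X j i.
Proof.
have [H [dot [J [hn [_ [_ [Jinj [_ [Jstar Jpos]]]]]]]]] := hV.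
move=> /Jpos[hX _]; apply: Jinj => x; apply: (dot_ext hn) => y.
by rewrite Jstar starK hX.
Qed.

(** The form of diag(X, X) at a vector is the sum of the forms of X at its two halves. *)
Lemma mo_pos_diag n (X : 'M[V]_n) : mo_pos X -> mo_pos (block_mx X 0 0 X).
Proof.
have [H [dot [J [_ [_ [Jlin [_ [_ [_ Jpos]]]]]]]]] := hV.
have J0 x : J 0 x = 0.
  by have := Jlin (-1) 0 0 x; rewrite scaler0 addr0 scaleN1r addNr.
move=> /Jpos[hX hX0]; apply/Jpos; split=> [i j x y|x].
  case: (split_ordP i) => {}i ->; case: (split_ordP j) => {}j ->;
  rewrite ?block_mxEul ?block_mxEur ?block_mxEdl ?block_mxEdr ?hX // !mxE.
    by rewrite !J0 linear0l linear0r.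
  by rewrite !J0 linear0l linear0r.
rewrite big_split_ord; apply: addr_ge0 => /=.
  have := hX0 (fun i => x (lshift n i)); congr (0 <= _).
  apply: eq_bigr => i _; rewrite big_split_ord /= [X in _ = _ + X]big1.
    by rewrite addr0; apply: eq_bigr => j _; rewrite block_mxEul.
  by move=> j _; rewrite block_mxEur mxE J0 linear0l.
have := hX0 (fun i => x (rshift n i)); congr (0 <= _).
apply: eq_bigr => i _; rewrite big_split_ord /= [X in _ = X + _]big1.
  by rewrite add0r; apply: eq_bigr => j _; rewrite block_mxEdr.
by move=> j _; rewrite block_mxEdl mxE J0 linear0l.
Qed.

End OperatorSystem.

(** * Extending real ucp maps to complexifications and restricting complex ones *)

Section ComplexExtension.
Variable R : realType.
Local Notation cj := (@Num.conj R[i] : involutive_rmorphism R[i]).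

Lemma mxC_linear m n (a : R[i]) (A B A' B' : 'M[R]_(m, n)) :
  mxC (complex.Re a *: A - complex.Im a *: B + A')
      (complex.Re a *: B + complex.Im a *: A + B') =
  a *: mxC A B + mxC A' B'.
Proof.
apply/matrixP => i j; rewrite !mxE.
by case: a => a b; apply/eqP; rewrite eq_complex /= !eqxx.
Qed.

Lemma mxC1 m : mxC 1%:M 0 = 1%:M :> 'M[R[i]]_m.
Proof.
apply/matrixP => i j; rewrite !mxE.
by case: (i == j); apply/eqP; rewrite eq_complex /= !eqxx.
Qed.

Lemma mxC_tens m n p q (A : 'M[R]_(m, n)) (B : 'M[R]_(p, q)) :
  mxC (tensmx A B) 0 = tensmx (mxC A 0) (mxC B 0).
Proof.
apply/matrixP => i j; rewrite !mxE; apply/eqP.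
by rewrite eq_complex /= !mulr0 mul0r subr0 addr0 !eqxx.
Qed.

Lemma mxC_split m n (A B : 'M[R]_(m, n)) : mxC A B = mxC A 0 + ci R *: mxC B 0.
Proof.
apply/matrixP => i j; rewrite !mxE; apply/eqP.
by rewrite eq_complex /= !mul0r !mul1r ?subr0 ?addr0 ?add0r !eqxx.
Qed.

Section Extension.
Variables (V : real_mo_space R) (m : nat).
Variable (f : {linear V -> matrix_system (@idfun R) m}).

Definition cplx_ext (z : complexification V) : matrix_system cj m :=
  mxC (f z.1 : 'M[R]_m) (f z.2 : 'M[R]_m).

Lemma cplx_ext_cinl v : cplx_ext (cinl v) = mxC (f v : 'M[R]_m) 0.
Proof. by rewrite /cplx_ext /= raddf0. Qed.

Lemma cplx_ext_linear : linear cplx_ext.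
Proof.
move=> a z z'; rewrite /cplx_ext /= !raddfD raddfN /= !linearZ /= scalerN.
exact: mxC_linear.
Qed.

HB.instance Definition _ := GRing.isLinear.Build R[i] (complexification V)
  (matrix_system cj m) _ cplx_ext cplx_ext_linear.

(** Applying f entrywise preserves the block shape [x, -y; y, x], and [mxpos_block] translates the
    positive image back to M_m(C). *)
Lemma cplx_ext_ucp : ucp f -> ucp cplx_ext.
Proof.
case=> f1 fpos; split=> [|n Z [_ _ /fpos]].
  by rewrite -[LHS]/(mxC (f (mo_unit V) : 'M_m) (f 0)) f1 raddf0 mxC1.
rewrite map_block_mx map_mxN => /mxpos_block.
by congr (mo_pos _); apply/matrixP => i j; rewrite !mxE.
Qed.

End Extension.

Section TensorExtension.
Variables (V W : real_mo_space R) (m k : nat).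
Variables (f : {linear V -> matrix_system (@idfun R) m}).
Variables (g : {linear W -> matrix_system (@idfun R) k}).

(** Under [theta], the tensor product of the extensions is the extension of the tensor product;
    complex linearity reduces this to real pure tensors. *)
Lemma tensor_map_ext (z : complexification (min_tensor V W)) :
  tensor_map (cplx_ext f) (cplx_ext g) (theta z) =
  mxC (tensor_map f g z.1 : 'M[R]_(m * k)) (tensor_map f g z.2).
Proof.
have hiota (t : tensor V W) :
    tensor_map (cplx_ext f) (cplx_ext g) (iota_tensor t) =
    mxC (tensor_map f g t : 'M[R]_(m * k)) 0.
  elim/tensor_ind: t => [|v w|t t' IH IH'].
  - by rewrite !raddf0; apply/matrixP => i j; rewrite !mxE.
  - rewrite iota_tensorE !tensor_mapE mxC_tens /=.
    by rewrite !cplx_ext_cinl.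
  - rewrite !raddfD /= IH IH'; apply/matrixP => i j; rewrite !mxE.
    by apply/eqP; rewrite eq_complex /= addr0 !eqxx.
by rewrite /theta raddfD /= linearZ /= !hiota [in RHS]mxC_split.
Qed.

End TensorExtension.

Section Restriction.
Variables (V : real_mo_space R) (m : nat).
Variable (F : {linear complexification V -> matrix_system cj m}).

Definition real_restr (v : V) : matrix_system (@idfun R) (m + m) :=
  realify (F (cinl v) : 'M[R[i]]_m).

Lemma realify_linear a (A B : 'M[R[i]]_m) :
  realify ((real_complex R a : R[i]) *: A + B) = a *: realify A + realify B.
Proof.
rewrite /realify scale_block_mx add_block_mx; congr block_mx;
  apply/matrixP => i j; rewrite !mxE /=;
  by case: (A i j) (B i j) => [x y] [x' y'] /=;
     rewrite !mul0r ?subr0 ?addr0 // opprD mulrN.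
Qed.

Lemma real_restr_linear : linear real_restr.
Proof.
move=> a v v'; rewrite /real_restr cinlD cinlZ linearP /=; apply: realify_linear.
Qed.

HB.instance Definition _ := GRing.isLinear.Build R V
  (matrix_system (@idfun R) (m + m)) _ real_restr real_restr_linear.

Lemma realify1 : realify (1%:M : 'M[R[i]]_m) = 1%:M.
Proof. by rewrite -mxC1 /realify mxReC mxImC oppr0 -scalar_mx_block. Qed.

(** The imaginary part is zero, so the block matrix to test is diag(X, X). The cones of a bare
    [mo_space] are arbitrary sets, which is why the operator system hypothesis enters here. *)
Lemma mo_pos_cinl n (X : 'M[V]_n) : operator_system V ->
  mo_pos X -> mo_pos (map_mx (@cinl R V) X : 'M[complexification V]_n).
Proof.
move=> hV hX.
have hre : map_mx fst (map_mx (@cinl R V) X : 'M[cplx V]_n) = X.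
  by apply/matrixP => i j; rewrite !mxE.
have him : map_mx snd (map_mx (@cinl R V) X : 'M[cplx V]_n) = 0.
  by apply/matrixP => i j; rewrite !mxE.
rewrite /= hre him; split.
- by apply/matrixP => i j; rewrite !mxE (mo_pos_star hV _ _ hX).
- by apply/matrixP => i j; rewrite !mxE star0 oppr0.
- by rewrite oppr0; apply: mo_pos_diag.
Qed.

Lemma real_restr_ucp : operator_system V -> ucp F -> ucp real_restr.
Proof.
move=> hV [F1 Fpos]; split=> [|n X hX].
  rewrite -[LHS]/(realify (F (mo_unit (complexification V)) : 'M_m)) F1.
  exact: realify1.
have /mxpos_realify := Fpos _ _ (mo_pos_cinl hV hX).
by congr (mo_pos _); apply/matrixP => i j; rewrite !mxE.
Qed.

End Restriction.

(* For C = A + iB, the isometry (a, -ia) with |a|^2 = 1/2 intertwines C with its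
   realification, since [A, -B; B, A] (x, -ix) = (Cx, -iCx). *)
Definition half_isom m : 'M[R[i]]_(m + m, m) :=
  col_mx ((Complex 2^-1 2^-1)%:M) ((Complex 2^-1 (- 2^-1))%:M).

(** The scalar a = (1 + i)/2 has |a|^2 = 1/2 without any square root, and -ia = (1 - i)/2; the two
    blocks contribute one half each. *)
Lemma half_isomK m : mxadj cj (half_isom m) *m half_isom m = 1%:M.
Proof.
rewrite /mxadj /half_isom tr_col_mx map_row_mx mul_row_col !tr_scalar_mx.
rewrite !map_scalar_mx -!scalar_mxM -raddfD /=; congr _%:M.
rewrite !conj_complexE; apply/eqP; rewrite eq_complex /=.
by apply/andP; split; apply/eqP; field.
Qed.

Lemma mxC_realify m (C : 'M[R[i]]_m) :
  mxC (realify C) 0 *m half_isom m = half_isom m *m C.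
Proof.
have -> : mxC (realify C) 0 =
    block_mx (mxC (mxRe C) 0) (mxC (- mxIm C) 0) (mxC (mxIm C) 0)
      (mxC (mxRe C) 0).
  apply/matrixP => i j; rewrite [LHS]mxE /realify.
  case: (split_ordP i) => {}i ->; case: (split_ordP j) => {}j ->;
  by rewrite ?block_mxEul ?block_mxEur ?block_mxEdl ?block_mxEdr !mxE.
rewrite mul_block_col mul_col_mx !mul_mx_scalar !mul_scalar_mx.
congr col_mx; apply/matrixP => i j; rewrite !mxE; case: (C i j) => a b;
by apply/eqP; rewrite eq_complex /=; apply/andP; split; apply/eqP; ring.
Qed.

Lemma half_isom_compress m (C : 'M[R[i]]_m) :
  mxadj cj (half_isom m) *m mxC (realify C) 0 *m half_isom m = C.
Proof. by rewrite -mulmxA mxC_realify mulmxA half_isomK mul1mx. Qed.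

Lemma mxadj_tens m n p q (A : 'M[R[i]]_(m, n)) (B : 'M[R[i]]_(p, q)) :
  mxadj cj (tensmx A B) = tensmx (mxadj cj A) (mxadj cj B).
Proof. by apply/matrixP => i j; rewrite !mxE rmorphM. Qed.

Section TensorRestriction.
Variables (V W : real_mo_space R) (m k : nat).
Variable (F : {linear complexification V -> matrix_system cj m}).
Variable (G : {linear complexification W -> matrix_system cj k}).
Let T := tensmx (half_isom m) (half_isom k).

(** On pure tensors the mixed product rule for Kronecker products separates the two factors, and
    each one is recovered by [half_isom_compress]. *)
Lemma tensor_map_restr (z : complexification (min_tensor V W)) :
  tensor_map F G (theta z) =
  mxadj cj T *m mxC (tensor_map (real_restr F) (real_restr G) z.1 : 'M[R]_(_ * _))
     (tensor_map (real_restr F) (real_restr G) z.2) *m T.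
Proof.
have hiota (t : tensor V W) :
    tensor_map F G (iota_tensor t) =
    mxadj cj T *m
      mxC (tensor_map (real_restr F) (real_restr G) t : 'M[R]_(_ * _)) 0 *m T.
  elim/tensor_ind: t => [|v w|t t' IH IH'].
  - rewrite !raddf0 (_ : mxC 0 0 = 0) ?mulmx0 ?mul0mx //.
    by apply/matrixP => i j; rewrite !mxE.
  - rewrite iota_tensorE !tensor_mapE mxC_tens mxadj_tens !tensmx_mul.
    by rewrite /= !half_isom_compress.
  - rewrite !raddfD /= IH IH'.
    rewrite -mulmxDl -mulmxDr; congr (_ *m _ *m _).
    apply/matrixP => i j; rewrite !mxE.
    by apply/eqP; rewrite eq_complex /= addr0 !eqxx.
rewrite /theta raddfD /= linearZ /= !hiota.
by rewrite [in RHS]mxC_split mulmxDr mulmxDl -scalemxAr -scalemxAl.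
Qed.

End TensorRestriction.
End ComplexExtension.

(** * Separating the points of an algebraic tensor product by products of functionals *)

Section TensorSeparation.
Variables (F : fieldType) (V W : lmodType F).

Lemma balanced_sumr (U : zmodType) (b : V -> W -> U) v n (w : 'I_n -> W) :
  balanced b -> b v (\sum_i w i) = \sum_i b v (w i).
Proof.
case=> _ hr _; apply: (big_morph (b v)) => //.
by apply: (@addrI _ (b v 0)); rewrite -hr !addr0.
Qed.

(** A linear relation among the w_i is solved for w_k and absorbed into the other terms, which
    shortens the sum by one. Any balanced b is allowed, so that the tensor and its values under
    functionals shrink in the same way. *)
Lemma balanced_reduce (U : zmodType) (b : V -> W -> U) n (v : 'I_n.+1 -> V)
    (w : 'I_n.+1 -> W) (k : 'I_n.+1) (a : 'I_n.+1 -> F) :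
  balanced b -> a k != 0 -> \sum_i a i *: w i = 0 ->
  \sum_i b (v i) (w i) =
  \sum_j b (v (lift k j) - (a (lift k j) / a k) *: v k) (w (lift k j)).
Proof.
move=> hb ak0 hw; have [hl _ hZ] := hb.
have wk : w k = \sum_j - (a (lift k j) / a k) *: w (lift k j).
  have := hw; rewrite (bigD1_ord k) //= => /(congr1 ( *:%R (a k)^-1)).
  rewrite scaler0 scalerDr scalerA mulVf // scale1r => /eqP.
  rewrite addr_eq0 => /eqP ->; rewrite scaler_sumr -sumrN.
  by apply: eq_bigr => j _; rewrite scalerA scaleNr mulrC.
rewrite (bigD1_ord k) //= {1}wk balanced_sumr // -big_split /=.
by apply: eq_bigr => j _; rewrite -hZ scaleNr addrC hl.
Qed.

Variables (Phi : (V -> F) -> Prop) (Psi : (W -> F) -> Prop).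
Hypothesis Phi_linear : forall phi, Phi phi -> scalar phi.
Hypothesis Psi_linear : forall psi, Psi psi -> scalar psi.
Hypothesis Phi_sep : forall v, (forall phi, Phi phi -> phi v = 0) -> v = 0.
Hypothesis Psi_sep : forall w, (forall psi, Psi psi -> psi w = 0) -> w = 0.

Lemma scalar0 (U : lmodType F) (phi : U -> F) : scalar phi -> phi 0 = 0.
Proof.
by move=> hphi; have := hphi (-1) 0 0; rewrite scaler0 addr0 mulN1r addNr.
Qed.

Lemma scalar_sum (U : lmodType F) (phi : U -> F) n (a : 'I_n -> F)
    (u : 'I_n -> U) :
  scalar phi -> phi (\sum_i a i *: u i) = \sum_i a i * phi (u i).
Proof.
move=> hphi; have phi0 := scalar0 hphi.
have phiD : {morph phi : x y / x + y}.
  by move=> x y; rewrite -[x in LHS]scale1r hphi mul1r.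
rewrite (big_morph phi phiD phi0); apply: eq_bigr => i _.
by rewrite -[_ *: _]addr0 hphi phi0 addr0.
Qed.

(** Induction on the number of terms: if the w_i are dependent, the sum gets shorter; if they are
    independent, all v_i vanish. *)
Lemma sum_tensor_separated n (v : 'I_n -> V) (w : 'I_n -> W) :
  (forall phi psi, Phi phi -> Psi psi ->
    \sum_i phi (v i) * psi (w i) = 0) ->
  \sum_i v i ⊗ w i = 0.
Proof.
elim: n v w => [|n IH] v w h; first by rewrite big_ord0.
have [[a [k [ak0 hw]]]|indep] :=
    pselect (exists a k, a k != 0 /\ \sum_i a i *: w i = 0).
  have tb : balanced (@tens F V W).
    split=> *; [exact: tensDl | exact: tensDr | by rewrite tensZl tensZr].
  rewrite (balanced_reduce v tb ak0 hw); apply: IH => phi psi hphi hpsi.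
  have b : balanced (fun x y => phi x * psi y).
    have hl := Phi_linear hphi; have hr := Psi_linear hpsi.
    have phi0 := scalar0 hl; have psi0 := scalar0 hr.
    split=> [x x' y|x y y'|c x y].
    - by rewrite -[x in LHS]scale1r hl mul1r mulrDl.
    - by rewrite -[y in LHS]scale1r hr mul1r mulrDr.
    - rewrite -[c *: x]addr0 -[c *: y]addr0 hl hr phi0 psi0 !addr0.
      by rewrite mulrCA mulrA.
  by rewrite -(balanced_reduce v b ak0 hw) h.
(* For fixed phi, the vector ∑ phi(v_i) w_i is killed by all of [Psi], hence is zero; a nonzero
   phi(v_i) would make it a linear relation. *)
have v0 i : v i = 0.
  apply: Phi_sep => phi hphi; apply/eqP/negP => /negP vi0; apply: indep.
  exists (fun i => phi (v i)), i; split=> //.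
  apply: Psi_sep => psi hpsi; rewrite (scalar_sum _ _ (Psi_linear hpsi)).
  exact: h.
by apply: big1 => i _; rewrite v0 tens0l.
Qed.

End TensorSeparation.

(** * Compressions of a represented real operator system to finite orthonormal families *)

Section Compression.
Variables (R : realType) (V : real_mo_space R).
Local Notation rid := (@idfun R : involutive_rmorphism R).

(** Compatibility with the star is not among the clauses of [ucp]; compressions have it by
    construction, so it is recorded separately. *)
Definition selfadjoint m (f : V -> matrix_system rid m) : Prop :=
  forall v, f (star v) = mxadj rid (f v : 'M[R]_m).

Variables (H : completeNormedModType R) (dot : {dot H for @idfun R}).

Lemma dotZl a (x y : H) : dot (a *: x) y = a * dot x y.
Proof. exact: (linearZl_LR dot). Qed.
Lemma dotZr a (x y : H) : dot x (a *: y) = a * dot x y.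
Proof. exact: (linearZr_LR dot). Qed.
Lemma dotC (x y : H) : dot x y = dot y x.
Proof. by rewrite hermC expr0 mul1r. Qed.

Lemma dot_suml n (x : 'I_n -> H) y : dot (\sum_i x i) y = \sum_i dot (x i) y.
Proof.
by apply: (big_morph (dot^~ y)) => [x1 x2|]; [exact: linearDl | exact: linear0l].
Qed.

Lemma dot_sumr n x (y : 'I_n -> H) : dot x (\sum_i y i) = \sum_i dot x (y i).
Proof. exact: raddf_sum. Qed.

Variable J : V -> {linear H -> H}.
Hypothesis Jlin : forall a v w x, J (a *: v + w) x = a *: J v x + J w x.
Hypothesis J1 : forall x, J (mo_unit V) x = x.
Hypothesis Jstar : forall v x y, dot (J v x) y = dot x (J (star v) y).
Hypothesis Jpos : forall n (X : 'M[V]_n),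
  mo_pos X -> block_positive dot (fun i j => J (X i j)).

(** The map is v ↦ E* J(v) E, where E sends the standard basis of R^m to the family e;
    orthonormality makes it unital. *)
Lemma compression_ucp m (e : 'I_m -> H) :
  (forall i j, dot (e i) (e j) = (i == j)%:R) ->
  exists f : {linear V -> matrix_system rid m},
    [/\ ucp f, selfadjoint f &
        forall v i j, (f v : 'M_m) i j = dot (J v (e j)) (e i)].
Proof.
move=> he.
pose f0 (v : V) : matrix_system rid m :=
  \matrix_(i, j) dot (J v (e j)) (e i) : 'M[R]_m.
have f0_linear : linear f0.
  move=> a v w; apply/matrixP => i j; rewrite !mxE Jlin.
  by rewrite linearDl /= dotZl.
pose f : {linear V -> matrix_system rid m} :=
  HB.pack f0 (GRing.isLinear.Build R V (matrix_system rid m) _ f0 f0_linear).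
exists f; split; last by move=> v i j; rewrite mxE.
  split=> [|n X hX].
    by apply/matrixP => i j; rewrite !mxE J1 he eq_sym.
  have [hJ hJ0] := Jpos hX; apply/mxposP; split=> [i j|x].
    by apply/matrixP => k l; rewrite !mxE /= hJ dotC.
  (* The matrix form at x is the operator form at the vectors E x_i. *)
  have := hJ0 (fun i => \sum_k x i k 0 *: e k); congr (0 <= _).
  apply: eq_bigr => i _; apply: eq_bigr => j _.
  rewrite dot_sumr; apply: eq_bigr => k _.
  rewrite dotZr raddf_sum /= dot_suml mxE mulr_suml mulr_sumr.
  apply: eq_bigr => l _. rewrite linearZ_LR dotZl !mxE.
  by rewrite /= mulrC [x j l 0 * _]mulrC.
by move=> v; apply/matrixP => i j; rewrite !mxE /= Jstar starK dotC.
Qed.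

Hypothesis hnorm : forall x : H, `|x| ^+ 2 = dot x x.

Lemma dot_unit (x : H) : x != 0 -> dot (`|x|^-1 *: x) (`|x|^-1 *: x) = 1.
Proof.
by move=> x0; rewrite dotZl dotZr -hnorm expr2 mulKf ?mulVf ?normr_eq0.
Qed.

(** Over the reals the numbers ⟨J v e, e⟩ do not determine J v, since they vanish for skew
    operators. Compressions to orthonormal pairs supply the off-diagonal values. *)
Lemma compression_separates v :
  (forall m (f : {linear V -> matrix_system rid m}) (i j : 'I_m),
     ucp f -> selfadjoint f -> (f v : 'M_m) i j = 0) ->
  forall x, J v x = 0.
Proof.
move=> hf.
have J0 m (e : 'I_m -> H) :
    (forall i j, dot (e i) (e j) = (i == j)%:R) ->
    forall i j, dot (J v (e i)) (e j) = 0.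
  by move=> /compression_ucp[f [fu fs fE]] i j; rewrite -fE hf.
have unit_vec (x : H) : x != 0 ->
    exists2 e, dot e e = 1 & x = `|x| *: e.
  move=> x0; exists (`|x|^-1 *: x); first exact: dot_unit.
  by rewrite scalerA mulfV ?scale1r // normr_eq0.
have Jdiag e : dot e e = 1 -> dot (J v e) e = 0.
  move=> he; apply: (J0 1 (fun=> e) _ ord0 ord0) => i j.
  by rewrite !ord1 eqxx.
have Joff e e' : dot e e = 1 -> dot e' e' = 1 -> dot e e' = 0 ->
    dot (J v e) e' = 0.
  move=> he he' hee'.
  apply: (J0 2 (fun i => if i == ord0 then e else e') _ ord0 ord_max) => i j.
  case: i => [[|[|//]]] ?; case: j => [[|[|//]]] ?; rewrite -?val_eqE //=.
  by rewrite dotC.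
move=> x; apply: (dot_ext hnorm) => y; rewrite linear0l.
have [->|x0] := eqVneq x 0; first by rewrite raddf0 linear0l.
have [e he ->] := unit_vec x x0; rewrite linearZ_LR dotZl.
(* Gram-Schmidt: y is a multiple of e plus a remainder r orthogonal to e, handled by [Jdiag] and
   [Joff] respectively. *)
pose r := y - dot e y *: e.
have -> : y = dot e y *: e + r by rewrite addrC subrK.
rewrite linearDr /= dotZr Jdiag // mulr0 add0r.
have [->|r0] := eqVneq r 0; first by rewrite linear0r mulr0.
have [e' he' hr] := unit_vec r r0; rewrite hr dotZr Joff ?mulr0 //.
have : dot e r = 0 by rewrite linearBr /= dotZr he mulr1 subrr.
by rewrite hr dotZr => /eqP; rewrite mulf_eq0 normr_eq0 (negPf r0) => /eqP.
Qed.

End Compression.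

(** * Pairs of real ucp maps separate the points of V ⊗ W *)

Section MinTensorReal.
Variables (R : realType) (V W : real_mo_space R).
Hypotheses (hV : operator_system V) (hW : operator_system W).
Local Notation rid := (@idfun R : involutive_rmorphism R).

Lemma ucp_separates (U : real_mo_space R) (u : U) : operator_system U ->
  (forall m (f : {linear U -> matrix_system rid m}) (i j : 'I_m),
     ucp f -> selfadjoint f -> (f u : 'M_m) i j = 0) -> u = 0.
Proof.
move=> [H [dot [J [hn [_ [Jlin [Jinj [J1 [Jstar Jpos]]]]]]]]] hu.
apply: Jinj => x.
have J0 : J 0 x = 0.
  by have := Jlin (-1) 0 0 x; rewrite scaler0 addr0 scaleN1r addNr.
rewrite J0; apply: (compression_separates Jlin J1 Jstar _ hn hu) => n X.
by move=> /Jpos.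
Qed.

(** The separating functionals are the matrix entries of star-compatible ucp maps. A product of two
    of them is an entry of the Kronecker product, at the indices joined by [mxtens_index]. *)
Lemma min_tensor_separated (t : tensor V W) :
  (forall m k (f : {linear V -> matrix_system rid m})
          (g : {linear W -> matrix_system rid k}),
     ucp f -> ucp g -> selfadjoint f -> selfadjoint g ->
     tensor_map f g t = 0) ->
  t = 0.
Proof.
move=> ht.
pose entry (U : real_mo_space R) (phi : U -> R) :=
  exists m (f : {linear U -> matrix_system rid m}) (i j : 'I_m),
    [/\ ucp f, selfadjoint f & forall u, phi u = (f u : 'M_m) i j].
have entry_linear U phi : entry U phi -> scalar phi.
  move=> [m [f [i [j [_ _ fE]]]]] a u u'.
  by rewrite !fE linearP !mxE.
have entry_sep (U : real_mo_space R) : operator_system U ->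
    forall u : U, (forall phi, entry U phi -> phi u = 0) -> u = 0.
  move=> hU u hu; apply: ucp_separates => // m f i j fu fs.
  by apply: (hu (fun u => (f u : 'M_m) i j)); exists m, f, i, j.
rewrite [t]tens_span (big_nth (0, 0)) big_mkord.
apply: (sum_tensor_separated (@entry_linear V) (@entry_linear W)
  (entry_sep V hV) (entry_sep W hW)).
move=> phi psi [m [f [i [j [fu fs fE]]]]] [k [g [i' [j' [gu gs gE]]]]].
have /matrixP /(_ (mxtens_index (i, i')) (mxtens_index (j, j'))) :=
  ht m k f g fu gu fs gs.
rewrite [RHS]mxE => ht0; rewrite -[RHS]ht0 /tensor_map /tlift /tsum.
rewrite (big_nth (0, 0)) big_mkord summxE.
by apply: eq_bigr => l _; rewrite tensmxE fE gE.
Qed.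

Lemma min_tensor_eq (t t' : tensor V W) :
  (forall m k (f : {linear V -> matrix_system rid m})
          (g : {linear W -> matrix_system rid k}),
     ucp f -> ucp g -> selfadjoint f -> selfadjoint g ->
     tensor_map f g t = tensor_map f g t') ->
  t = t'.
Proof.
move=> htt'; apply/eqP; rewrite -subr_eq0; apply/eqP.
apply: min_tensor_separated => m k f g fu gu fs gs.
by rewrite raddfB /= htt' // subrr.
Qed.

Lemma tensor_map_star m k (f : {linear V -> matrix_system rid m})
    (g : {linear W -> matrix_system rid k}) (t : tensor V W) :
  selfadjoint f -> selfadjoint g ->
  tensor_map f g (tstar t) = mxadj rid (tensor_map f g t : 'M[R]_(m * k)).
Proof.
move=> fs gs; elim/tensor_ind: t => [|v w|t t' IH IH'].
- by rewrite tstar0 !raddf0; apply/matrixP => i j; rewrite !mxE.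
- rewrite tstarE !tensor_mapE fs gs.
  by apply/matrixP => i j; rewrite !mxE.
- rewrite tstarD !raddfD /= IH IH'.
  by apply/matrixP => i j; rewrite !mxE.
Qed.

End MinTensorReal.

(** * Agreement of the matrix cones under [theta] *)

Theorem corollary10p4 (R : realType) (V W : real_mo_space R)
    (hV : operator_system V) (hW : operator_system W) :
  exists theta : {linear complexification (min_tensor V W) ->
                         min_tensor (complexification V) (complexification W)},
    (forall (v : V) (w : W),
       theta (v ⊗ w, 0) =
       ((v, 0) : complexification V) ⊗ ((w, 0) : complexification W)) /\
    unital_complete_order_iso theta.
Proof.
exists (@theta R V W); split; first exact: theta_cinl.
split=> [|||n Z].
- by exists (@theta_inv R V W); [apply: thetaK | apply: theta_invK].
- exact: theta_cinl.
- exact: theta_star.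
split=> [[_ _ hZ] m k F G Fu Gu|hZ].
  (* A complex test pair is replaced by its real restrictions; the values of F and G come back by
     compressing with the tensor product of the two isometries. *)
  have := hZ _ _ (real_restr F) (real_restr G) (real_restr_ucp hV Fu)
    (real_restr_ucp hW Gu).
  rewrite map_block_mx map_mxN => /mxpos_block.
  apply: (mxpos_compress (T := tensmx (half_isom R m) (half_isom R k))) => i j.
  by rewrite !mxE [LHS]tensor_map_restr.
(* Conversely, a real test pair is extended, and positivity of the extended values is expressed
   through real and imaginary parts of Z. *)
have hfg m k (f : {linear V -> matrix_system idfun m})
    (g : {linear W -> matrix_system idfun k}) : ucp f -> ucp g ->
  mo_pos (map2_mx (@mxC R (m * k) (m * k)) (map_mx (tensor_map f g) (map_mx fst Z))
             (map_mx (tensor_map f g) (map_mx snd Z))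
           : 'M[matrix_system (@Num.conj R[i]) (m * k)]_n).
  move=> fu gu.
  have := hZ _ _ (cplx_ext f) (cplx_ext g) (cplx_ext_ucp fu) (cplx_ext_ucp gu).
  by congr (mo_pos _); apply/matrixP => i j; rewrite !mxE [LHS]tensor_map_ext.
(* Positive matrices are selfadjoint, so every test pair sees a symmetric real part and an
   antisymmetric imaginary part of Z. *)
have hadj m k (f : {linear V -> matrix_system idfun m})
    (g : {linear W -> matrix_system idfun k}) i j : ucp f -> ucp g ->
  mxC (mxadj idfun (tensor_map f g (Z i j).1 : 'M_(m * k)))
      (- mxadj idfun (tensor_map f g (Z i j).2 : 'M_(m * k))) =
  mxC (tensor_map f g (Z j i).1 : 'M_(m * k)) (tensor_map f g (Z j i).2).
  move=> fu gu; have := mxpos_adj i j (hfg m k f g fu gu).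
  by rewrite !mxE mxadjC mxReC mxImC.
split.
(* Since star-compatible test pairs separate points, the symmetry seen in the matrix values already
   holds in V ⊗ W; the antisymmetry of the imaginary part follows in the same way. *)
- apply/matrixP => i j; rewrite !mxE.
  apply: (min_tensor_eq hV hW) => m k f g fu gu fs gs.
  rewrite [RHS]tensor_map_star //.
  by have := congr1 (@mxRe R _ _) (hadj m k f g j i fu gu); rewrite !mxReC.
- apply/matrixP => i j; rewrite !mxE.
  apply: (min_tensor_eq hV hW) => m k f g fu gu fs gs.
  rewrite [RHS](raddfN (tensor_map f g)) /= [in RHS]tensor_map_star //.
  by have := congr1 (@mxIm R _ _) (hadj m k f g j i fu gu); rewrite !mxImC.
- move=> m k f g fu gu; have /mxpos_block := hfg m k f g fu gu.
  by rewrite map_block_mx map_mxN.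
Qed.
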